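(* Every multipartite hypertournament with at most one transmitter has a 4-king. That is, for all integers $n>k\ge 2$ and $p\ge 2$, every $p$-partite $k$-hypertournament on $n$ vertices that has at most one transmitter contains a 4-king.
   Context: Let $n>k\ge 2$ be integers. A $k$-hypertournament on a vertex set $V$ with $|V|=n$ is a pair $(V,A)$, where $A$ is a set of $k$-tuples of distinct vertices (called arcs) such that for every $k$-subset $S$ of $V$, $A$ contains exactly one of the $k!$ tuples whose entries are the elements of $S$. For an arc $x_1x_2\ldots x_k$, $x_i$ precedes $x_j$ if $i<j$. Let $V=V_1\uplus\dots\uplus V_p$ be a partition of $V$ into $p\ge 2$ non-empty subsets (partite sets). A $p$-partite $k$-hypertournament (or multipartite hypertournament) $H$ with these partite sets is obtained from a $k$-hypertournament on $V$ by deleting all arcs whose vertices are all contained in a single $V_i$. Its arc set is denoted $A(H)$. For vertices $u,w$ in different partite sets, $A_H(u,w)$ is the set of arcs of $H$ that contain both $u$ and $w$ and in which $u$ precedes $w$. If $u,w$ are in the same partite set, $A_H(u,w)=\emptyset$. A path in $H$ of length $q-1$ from $x_1$ to $x_q$ (an $(x_1,x_q)$-path) is an alternating sequence $x_1a_1x_2a_2\dots x_{q-1}a_{q-1}x_q$ of distinct vertices $x_i$ and distinct arcs $a_j$ such that $a_j\in A_H(x_j,x_{j+1})$ for every $j\in\{1,\dots,q-1\}$. (The single vertex $x$ is an $(x,x)$-path of length $0$.) For an integer $q\ge1$, a vertex $x$ is a $q$-king of $H$ if for every vertex $y$ there is an $(x,y)$-path of length at most $q$ in $H$. A vertex $v$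 is a transmitter of $H$ if $A_H(u,v)=\emptyset$ for every vertex $u$ in a different partite set from $v$. *)

(* Defs.v *)
From mathcomp Require Import all_boot.

Set Implicit Arguments.
Unset Strict Implicit.
Unset Printing Implicit Defensive.

Section Hypertournaments.

Variables (V : finType) (k : nat).

Implicit Types (P : {set {set V}}) (A T : {set k.-tuple V}).

Definition hypertournament A : Prop :=
  (forall a : k.-tuple V, a \in A -> uniq a) /\
  (forall S : {set V}, #|S| = k ->
     exists! a : k.-tuple V, a \in A /\ [set x in a] = S).

Definition multipartite_hypertournament P A : Prop :=
  exists2 T, hypertournament T &
    A = [set a in T | ~~ [exists X in P, [set x in a] \subset X]].

(* The strict inequality index u a < index w a, with w \in a, already forces
   u \in a; arcs have distinct entries, so index gives the unique position. *)
Definition arcs_between P A (u w : V) : {set k.-tuple V} :=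
  if pblock P u == pblock P w then set0
  else [set a in A | [&& u \in a, w \in a & index u a < index w a]].

(* The walk x, a_1, x_2, a_2, ..., x_q is encoded by its first vertex x and
   the sequence of steps (a_1, x_2), (a_2, x_3), ..., (a_(q-1), x_q). *)
Fixpoint hwalk P A (x : V) (s : seq (k.-tuple V * V)) : bool :=
  if s is (a, y) :: s' then (a \in arcs_between P A x y) && hwalk P A y s'
  else true.

Definition hpath P A (x y : V) (s : seq (k.-tuple V * V)) : bool :=
  [&& hwalk P A x s, uniq (x :: unzip2 s), uniq (unzip1 s)
    & last x (unzip2 s) == y].

Definition king P A (q : nat) (x : V) : Prop :=
  forall y : V, exists2 s, hpath P A x y s & size s <= q.

Definition transmitter P A (v : V) : bool :=
  [forall u : V, (pblock P u != pblock P v) ==> (arcs_between P A u v == set0)].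

End Hypertournaments.

(* Main.v *)
(* Write f(u, w) for the number of arcs in which u precedes w, and draw an edge
   u -> w between different parts when f(w, u) <= f(u, w). This digraph is
   semicomplete multipartite. A source of it (or a transmitter of H, if there is
   one) is a 2-king of H. Otherwise the digraph has a 4-king: a quasi-kernel is
   an independent set, hence lies in one part, and a vertex of maximum outdegree
   in that part reaches every vertex within 4 steps.

   It remains to turn a path of length at most 4 into one with distinct arcs.
   This is automatic for k = 2. For k >= 3 and n >= 5, f(u, w) + f(w, u) >= n - 2,
   so each edge carries at least 2 arcs, and at least 3 if k > 5. An arc serving
   three consecutive edges gives a shortcut, as u, w, z with u, z in one part and
   w, z in different parts forces u, w in different parts; without such an arc
   the four arc sets have distinct representatives. For n = 4, k = 3 an obstructed
   path either has a shortcut or exhibits another vertex which is a king. *)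
Require Import Defs.
From mathcomp Require Import all_boot.

Set Implicit Arguments.
Unset Strict Implicit.
Unset Printing Implicit Defensive.

(** * Kings of semicomplete multipartite digraphs *)

Section SemicompleteKings.

Variables (V : finType) (C : eqType) (c : V -> C) (e : rel V).

(** The Chvátal-Lovász quasi-kernel theorem, by induction on [#|S|]: delete some [v] and its
    out-neighbours and take [Q] for the rest. If some [q] in [Q] has an edge to [v], then [Q] still
    works, since the deleted out-neighbours are two steps from [q]; otherwise [v] is added to
    [Q]. *)
Lemma quasi_kernel (S : {set V}) : irreflexive e ->
  exists2 Q : {set V}, {in Q &, forall u w, ~~ e u w} &
    {in S, forall y, [\/ y \in Q, exists2 q, q \in Q & e q y
                      | exists q w, [/\ q \in Q, e q w & e w y]]}.
Proof.
move=> e_irr.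
(* The inclusion of [Q] in [S] is carried through the induction: it ensures that [v] has no edge
   into [Q]. *)
suff [Q [_ indQ domQ]] : exists Q : {set V}, [/\ Q \subset S,
    {in Q &, forall u w, ~~ e u w} &
    {in S, forall y, [\/ y \in Q, exists2 q, q \in Q & e q y
                      | exists q w, [/\ q \in Q, e q w & e w y]]}].
  by exists Q.
have [m] := ubnP #|S|; elim: m S => // m IHm S leSm.
have [->|[v Sv]] := set_0Vmem S.
  by exists set0; split=> // [u|y]; rewrite inE.
have [|Q [sQ indQ domQ]] := IHm [set y in S | (y != v) && ~~ e v y].
  rewrite -ltnS; apply: leq_trans leSm; rewrite ltnS; apply/proper_card/properP.
  split; first by apply/subsetP=> y; rewrite inE => /andP[].
  by exists v; rewrite // inE eqxx andbF.
have sQS : Q \subset S.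
  by apply: subset_trans sQ _; apply/subsetP=> y; rewrite inE => /andP[].
have [/exists_inP[q Qq eqv]|/exists_inPn noQv] := boolP [exists q in Q, e q v].
  exists Q; split=> // y Sy.
  have [->|nyv] := eqVneq y v; first by constructor 2; exists q.
  have [evy|nevy] := boolP (e v y); first by constructor 3; exists q, v.
  by apply: domQ; rewrite inE Sy nyv.
exists (v |: Q); split.
- by apply/subsetP=> y /setU1P[->|/(subsetP sQS)].
- move=> u w /setU1P[->|Qu] /setU1P[->|Qw]; first by rewrite e_irr.
  + by move/(subsetP sQ): Qw; rewrite inE => /and3P[].
  + exact: noQv.
  + exact: indQ.
move=> y Sy; have [->|nyv] := eqVneq y v; first by constructor 1; rewrite setU11.
have [evy|nevy] := boolP (e v y).
  by constructor 2; exists v; rewrite // setU11.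
have [|Qy|[q Qq eqy]|[q [w [Qq eqw ewy]]]] := domQ y.
- by rewrite inE Sy nyv.
- by constructor 1; rewrite setU1r.
- by constructor 2; exists q; rewrite // setU1r.
- by constructor 3; exists q, w; split; rewrite // setU1r.
Qed.

Hypothesis e_neq : forall u w, e u w -> c u != c w.
Hypothesis e_total : forall u w, c u != c w -> e u w || e w u.
Hypothesis no_source : forall v, exists u, e u v.

Let out x := [set y | e x y].

(* If x has maximum outdegree in its part and x' is in that part with x' -> y,
   then either x -> y or some z has x -> z -> x' -> y, as otherwise out x' would
   properly contain out x. *)
Lemma max_out_reach x x' y :
    (forall v, c v = c x -> #|out v| <= #|out x|) -> c x' = c x -> e x' y ->
  exists2 p, path e x p & last x p = y /\ size p <= 3.
Proof.
move=> maxx cx' ex'y; have [exy|nexy] := boolP (e x y).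
  by exists [:: y]; rewrite /= ?exy.
have [/exists_inP[z exz ezx']|/exists_inPn nox'] :=
  boolP [exists z in out x, e z x'].
  rewrite inE in exz.
  by exists [:: z; x'; y]; rewrite /= ?exz ?ezx' ?ex'y.
have /proper_card : out x \proper out x'.
  apply/properP; split; last by exists y; rewrite inE.
  apply/subsetP=> z xz; have:= nox' z xz; move: xz; rewrite !inE => xz nzx'.
  have /e_total : c x' != c z by rewrite cx' e_neq.
  by rewrite (negPf nzx') orbF.
by rewrite ltnNge maxx.
Qed.

(** By [e_total] a quasi-kernel [Q] lies in one part; let [x] have maximum outdegree there. Anything
    one edge away from that part is within 3 steps of [x], anything two edges away within 4. What
    remains is a vertex [y] of the part that is not two edges away from it; its in-neighbour [w]
    must then be at distance two from [Q]. *)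
Theorem semicomplete_king (v0 : V) : exists x, forall y,
  exists2 p, path e x p & last x p = y /\ size p <= 4.
Proof.
have e_irr : irreflexive e.
  by move=> u; apply/negP=> /e_neq; rewrite eqxx.
have [Q indQ domQ] := quasi_kernel [set: V] e_irr.
have [q0 Qq0] : exists q, q \in Q.
  by have [|[q Qq _]|[q [w [Qq _ _]]]] := domQ v0 (in_setT _);
    [exists v0 | exists q | exists q].
have Qc q : q \in Q -> c q = c q0.
  move=> Qq; apply/eqP; apply: contraT => /e_total.
  by rewrite (negPf (indQ _ _ Qq Qq0)) (negPf (indQ _ _ Qq0 Qq)).
have [x /eqP cx maxx] := @arg_maxnP _ q0 (fun v => c v == c q0)
  (fun v => #|out v|) (eqxx _).
have{} maxx v : c v = c x -> #|out v| <= #|out x|.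
  by move=> cv; apply: maxx; rewrite /= cv cx.
have extend w y : (exists2 u, c u = c x & e u w) -> e w y ->
    exists2 p, path e x p & last x p = y /\ size p <= 4.
  case=> u cu euw ewy; have [p xp [lp sp]] := max_out_reach maxx cu euw.
  by exists (rcons p y); rewrite ?rcons_path ?last_rcons ?size_rcons ?xp ?lp.
exists x => y.
have [Qy|[q Qq eqy]|[q [w [Qq eqw ewy]]]] := domQ y (in_setT _); last first.
- by apply: (extend w) => //; exists q; rewrite // Qc.
- have [|p xp [lp sp]] := max_out_reach maxx _ eqy; first by rewrite Qc.
  by exists p => //; split=> //; apply: ltnW.
have [/existsP[w /andP[ewy /exists_inP[u /eqP cu euw]]]|noext] :=
  boolP [exists w, e w y && [exists (u | c u == c x), e u w]].
  by apply: (extend w) => //; exists u.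
(* In-neighbours of y have none in the part of x, so out y contains all
   out-neighbours of that part; by maximality out x is that set too. *)
have [w ewy] := no_source y.
have no_in_w u : c u = c x -> ~~ e u w.
  move=> cu; apply: contra noext => euw; apply/existsP; exists w.
  by rewrite ewy; apply/exists_inP; exists u => //; apply/eqP.
have cy : c y = c x by rewrite cx Qc.
have outy u z : c u = c x -> e u z -> e y z.
  move=> cu euz; have /e_total/orP[//|ezy] : c y != c z.
    by rewrite cy -cu e_neq.
  case/negP: noext; apply/existsP; exists z; rewrite ezy.
  by apply/exists_inP; exists u => //; apply/eqP.
have eqout : out x = out y.
  apply/eqP; rewrite eqEcard maxx // andbT.
  by apply/subsetP=> z; rewrite !inE; apply: outy.
have [Qw|[q Qq eqw]|[q [z [Qq eqz ezw]]]] := domQ w (in_setT _).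
- by have:= e_neq ewy; rewrite (Qc _ Qw) cy cx eqxx.
- by case/negP: (no_in_w q (etrans (Qc q Qq) (esym cx))).
have exz : e x z.
  have: z \in out y by rewrite inE (outy q) // cx Qc.
  by rewrite -eqout inE.
by exists [:: z; w; y]; rewrite /= ?exz ?ezw ?ewy.
Qed.

End SemicompleteKings.

(** * Distinct representatives *)

(** Pascal's rule, down to ['C(m.+1, m)]. It turns the count of arcs through two vertices into the
    bound [n - 2]. *)
Lemma leq_bin_self m j : 0 < j < m -> m <= 'C(m, j).
Proof.
elim: m j => // m IHm [|j] //; rewrite /= ltnS => ltjm.
have [ltSjm|] := ltnP j.+1 m.
  by rewrite binS -addn1 leq_add ?IHm ?bin_gt0 // ltnW.
rewrite leq_eqVlt ltnNge ltjm orbF => /eqP->; exact/eq_leq/esym/binSn.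
Qed.

Lemma exists_other (T : finType) (B : {set T}) (d : T) :
  1 < #|B| -> exists2 b, b \in B & b != d.
Proof.
move=> gtB1; have /card_gt0P[b] : 0 < #|B :\ d|.
  by move: gtB1; rewrite (cardsD1 d); case: (d \in B) => //; apply: ltn_trans.
by rewrite !inE => /andP[nbd Bb]; exists b.
Qed.

Lemma exists_other2 (T : finType) (B : {set T}) (d d' : T) :
  2 < #|B| -> exists b, [/\ b \in B, b != d & b != d'].
Proof.
move=> gtB2; have [|b] := @exists_other T (B :\ d) d'.
  by move: gtB2; rewrite (cardsD1 d); case: (d \in B) => //; apply: ltn_trans.
by rewrite !inE => /andP[nbd Bb] nbd'; exists b.
Qed.

Ltac distinct :=
  rewrite /= ?inE ?negb_or ?andbT; repeat (apply/andP; split);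
  try by [| rewrite eq_sym].

Section DistinctRepresentatives.

Variable T : finType.
Implicit Types B : {set T}.

Definition distinct_reps4 B1 B2 B3 B4 :=
  exists b1 b2 b3 b4, [/\ [/\ b1 \in B1, b2 \in B2, b3 \in B3 & b4 \in B4]
                        & uniq [:: b1; b2; b3; b4]].

Lemma distinct_reps4_rev B1 B2 B3 B4 :
  distinct_reps4 B4 B3 B2 B1 -> distinct_reps4 B1 B2 B3 B4.
Proof.
move=> [b4 [b3 [b2 [b1 [[H4 H3 H2 H1]]]]]].
by rewrite -rev_uniq => u; exists b1, b2, b3, b4.
Qed.

(** An element [d] of [B1] is missing from [B2] or [B3]. With [d] chosen for [B1], that set is
    served last: only two of the chosen values can lie in it. *)
Lemma distinct_reps4_ge3 B1 B2 B3 B4 :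
    2 < #|B1| -> 2 < #|B2| -> 2 < #|B3| -> 2 < #|B4| ->
    [disjoint B1 :&: B2 & B3] ->
  distinct_reps4 B1 B2 B3 B4.
Proof.
move=> gt1 gt2 gt3 gt4 dis.
have [d d1] : exists d, d \in B1 by apply/card_gt0P; apply: leq_trans gt1.
have [d2|nd2] := boolP (d \in B2); last first.
  have [b3 b3B nb3] := exists_other d (ltnW gt3).
  have [b4 [b4B nb4 nb4']] := exists_other2 d b3 gt4.
  have [b2 [b2B nb2 nb2']] := exists_other2 b3 b4 gt2.
  exists d, b2, b3, b4; split=> //; distinct.
  by apply: contraNneq nd2 => ->.
have nd3 : d \notin B3 by rewrite (disjointFr dis) // inE d1 d2.
have [b2 b2B nb2] := exists_other d (ltnW gt2).
have [b4 [b4B nb4 nb4']] := exists_other2 d b2 gt4.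
have [b3 [b3B nb3 nb3']] := exists_other2 b2 b4 gt3.
exists d, b2, b3, b4; split=> //; distinct.
by apply: contraNneq nd3 => ->.
Qed.

(** Here [B2] is exactly [[set a1; a4]], so [B3] avoids both. Replacing [a1] in [B1] or [a4] in [B4]
    frees a value for [B2]; this fails only if [a1] and [a4] both lie in [B1 :&: B4], against the
    uniqueness hypothesis. *)
Lemma distinct_reps4_case B1 B2 B3 B4 a1 a4 :
    1 < #|B1| -> 1 < #|B2| -> 1 < #|B3| -> 1 < #|B4| ->
    [disjoint B2 & B3] ->
    {in B1 :&: B4 :&: B2 &, forall a b, a = b} ->
    a1 \in B1 -> a4 \in B4 -> a1 != a4 -> B2 \subset [set a1; a4] ->
  distinct_reps4 B1 B2 B3 B4.
Proof.
move=> gt1 gt2 gt3 gt4 dis23 one a1B a4B na14 B2s.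
have EB2 : B2 = [set a1; a4] by apply/eqP; rewrite eqEcard B2s cards2 na14.
have n1 b : b \in B3 -> b != a1.
  by apply: contraTneq => ->; rewrite (disjointFr dis23) // EB2 !inE eqxx.
have n4 b : b \in B3 -> b != a4.
  by apply: contraTneq => ->; rewrite (disjointFr dis23) // EB2 !inE eqxx orbT.
have [a1' a1'B na1'] := exists_other a1 gt1.
have [a4' a4'B na4'] := exists_other a4 gt4.
have [Ea1'|na1'4] := eqVneq a1' a4; last first.
  have [b3 b3B nb3] := exists_other a1' gt3.
  have := n1 b3 b3B; have := n4 b3 b3B.
  by exists a1', a1, b3, a4; split; [rewrite EB2 !inE eqxx | distinct].
have [Ea4'|na4'1] := eqVneq a4' a1; last first.
  have [b3 b3B nb3] := exists_other a4' gt3.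
  have := n1 b3 b3B; have := n4 b3 b3B.
  by exists a1, a4, b3, a4'; split; [rewrite EB2 !inE eqxx orbT | distinct].
case/eqP: na14; apply: one; rewrite EB2 !inE eqxx ?orbT andbT.
  by rewrite a1B -Ea4' a4'B.
by rewrite a4B -Ea1' a1'B.
Qed.

(** If [B2] and [B3] are disjoint, distinct [a1] and [a4] are fixed and [B2], [B3] avoid them,
    unless one of the two is contained in [[set a1; a4]], which is the preceding case. Otherwise
    some [a] lies in both, hence not in [B1] or [B4], and it can represent either [B2] or [B3]. *)
Lemma distinct_reps4_ge2 B1 B2 B3 B4 :
    1 < #|B1| -> 1 < #|B2| -> 1 < #|B3| -> 1 < #|B4| ->
    [disjoint B1 :&: B2 & B3] -> [disjoint B2 :&: B3 & B4] ->
    {in B1 :&: B4 :&: (B2 :|: B3) &, forall a b, a = b} ->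
  distinct_reps4 B1 B2 B3 B4.
Proof.
move=> gt1 gt2 gt3 gt4 dis123 dis234 one.
have [dis23|/pred0Pn[a /andP[/= aB2 aB3]]] := boolP [disjoint B2 & B3].
  have [a1 a1B] : exists a, a \in B1 by apply/card_gt0P; apply: ltnW.
  have [a4 a4B na41] := exists_other a1 gt4.
  have [B2s|/subsetPn[b2 b2B]] := boolP (B2 \subset [set a1; a4]).
    apply: distinct_reps4_case a1B a4B _ B2s; rewrite // 1?eq_sym //.
    by apply: sub_in2 one; apply/subsetP/setIS/subsetUl.
  have [B3s|/subsetPn[b3 b3B]] := boolP (B3 \subset [set a4; a1]).
    move=> _; apply: distinct_reps4_rev.
    apply: distinct_reps4_case a4B a1B _ B3s; rewrite // 1?disjoint_sym //.
    by rewrite [B4 :&: B1]setIC; apply: sub_in2 one; apply/subsetP/setIS/subsetUr.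
  rewrite !inE !negb_or => /andP[nb34 nb31] /andP[nb21 nb24].
  exists a1, b2, b3, a4; split=> //; distinct.
  by apply: contraTneq b3B => <-; rewrite (disjointFr dis23).
have aB1 : a \notin B1.
  by apply/negP=> aB1; have:= disjointFr dis123 (_ : a \in B1 :&: B2);
     rewrite inE aB1 aB2 aB3 => /(_ isT).
have aB4 : a \notin B4 by rewrite (disjointFr dis234) // inE aB2 aB3.
have na1 b : b \in B1 -> b != a by apply: contraTneq => ->.
have na4 b : b \in B4 -> b != a by apply: contraTneq => ->.
(* With [a] and [b] representing the middle sets, the outer sets can be served unless both contain
   [b]. If this blocks both ways of using [a], uniqueness gives [b2 = b3], an element of
   [B1 :&: B2 :&: B3]. *)
have outer b : b != a -> (b \in B1) && (b \in B4) \/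
    exists b1 b4, [/\ b1 \in B1, b4 \in B4 & uniq [:: b1; a; b; b4]].
  move=> nba.
  have [b1 b1B nb1] := exists_other b gt1; have [b4 b4B nb4] := exists_other b gt4.
  have nb1a := na1 _ b1B; have nb4a := na4 _ b4B.
  have [nb14|nb14] := eqVneq b1 b4; last first.
    by right; exists b1, b4; split=> //; distinct.
  have [bB1|nbB1] := boolP (b \in B1); last first.
    right; have [b1' b1'B nb1'] := exists_other b4 gt1; exists b1', b4.
    have nb1'a := na1 _ b1'B.
    by split=> //; distinct; apply: contraTneq b1'B => ->.
  have [bB4|nbB4] := boolP (b \in B4); first by left.
  right; have [b4' b4'B nb4'] := exists_other b1 gt4; exists b1, b4'.
  have nb4'a := na4 _ b4'B.
  by split=> //; distinct; apply: contraTneq b4'B => <-.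
have [b3 b3B nb3] := exists_other a gt3.
have [/andP[b31 b34]|[b1 [b4 [b1B b4B u]]]] := outer _ nb3; last first.
  by exists b1, a, b3, b4.
have [b2 b2B nb2] := exists_other a gt2.
have [/andP[b21 b24]|[b1 [b4 [b1B b4B u]]]] := outer _ nb2; last first.
  exists b1, b2, a, b4; split=> //.
  rewrite (perm_uniq (_ : perm_eq _ [:: b1; a; b2; b4])) //.
  by rewrite perm_cons (perm_catCA [:: b2] [:: a] [:: b4]).
have Eb : b2 = b3 by apply: one; rewrite !inE ?b21 ?b24 ?b31 ?b34 ?b2B ?b3B ?orbT.
have:= disjointFr dis123 (_ : b2 \in B1 :&: B2).
by rewrite Eb b3B inE b31 -Eb b2B => /(_ isT).
Qed.

End DistinctRepresentatives.

(** * Paths with distinct arcs *)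

Section Reachability.

Variables (V : finType) (k : nat) (P : {set {set V}}) (A : {set k.-tuple V}).
Implicit Types (u w x y z : V) (a b : k.-tuple V) (s : seq (k.-tuple V * V)).

Notation part := (pblock P).
Notation arcs := (arcs_between P A).

Definition reach q x y := exists2 s, hpath P A x y s & size s <= q.

Lemma reachW q r x y : q <= r -> reach q x y -> reach r x y.
Proof. by move=> leqr [s xys les]; exists s; rewrite ?(leq_trans les). Qed.

Lemma reach_refl q x : reach q x x.
Proof. by exists [::]; rewrite // /hpath /= eqxx. Qed.

Definition precedes a u w := [&& u \in a, w \in a & index u a < index w a].

Lemma precedes_trans a : transitive (precedes a).
Proof.
move=> w u z /and3P[ua _ ltuw] /and3P[_ za ltwz].
by rewrite /precedes ua za (ltn_trans ltuw).
Qed.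

Lemma mem_arcs a u w :
  (a \in arcs u w) = [&& part u != part w, a \in A & precedes a u w].
Proof.
by rewrite /arcs_between; case: eqP; rewrite ?inE // => _; rewrite in_set.
Qed.

Lemma arcs_part a u w : a \in arcs u w -> part u != part w.
Proof. by rewrite mem_arcs => /andP[]. Qed.

Lemma arcsA a u w : a \in arcs u w -> a \in A.
Proof. by rewrite mem_arcs => /and3P[]. Qed.

Lemma arcs_tail a u w : a \in arcs u w -> u \in a.
Proof. by rewrite mem_arcs => /and3P[_ _ /and3P[]]. Qed.

Lemma arcs_head a u w : a \in arcs u w -> w \in a.
Proof. by rewrite mem_arcs => /and3P[_ _ /and3P[]]. Qed.

Lemma arcs_precedes a u w : a \in arcs u w -> precedes a u w.
Proof. by rewrite mem_arcs => /and3P[]. Qed.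

Lemma precedes_arcs a u w :
  part u != part w -> a \in A -> precedes a u w -> a \in arcs u w.
Proof. by rewrite mem_arcs => -> ->. Qed.

Lemma hpath_suffix x y z s : hpath P A y z s -> x \in y :: unzip2 s ->
  exists s', [/\ hpath P A x z s', size s' <= size s
               & {subset unzip1 s' <= unzip1 s}].
Proof.
elim: s y => [|[a w] s IHs] y yzs.
  by rewrite mem_seq1 => /eqP->; exists [::].
rewrite inE => /predU1P[-> | xs]; first by exists ((a, w) :: s); split.
have [|s' [xzs' les' subs']] := IHs w _ xs.
  by move: yzs; rewrite /hpath /= => /and4P[/andP[_ ->] /andP[_ ->] /andP[_ ->] ->].
exists s'; split=> //; first exact: leqW.
by move=> b /subs'; rewrite /= inE orbC => ->.
Qed.

(** Loop erasure: if [x] recurs on the path built from the tail, the suffix from that occurrence is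
    kept. Hence later arguments need only distinct arcs, never distinct vertices. *)
Lemma hwalk_reach x s : hwalk P A x s -> uniq (unzip1 s) ->
  reach (size s) x (last x (unzip2 s)).
Proof.
(* Tracking which arcs survive keeps the prepended arc distinct from the rest. *)
suff loop : hwalk P A x s -> uniq (unzip1 s) ->
    exists s', [/\ hpath P A x (last x (unzip2 s)) s', size s' <= size s
               & {subset unzip1 s' <= unzip1 s}].
  by move=> walks us; have [s' [? ? _]] := loop walks us; exists s'.
elim: s x => [|[a y] s IHs] x /=.
  by exists [::]; rewrite /hpath /= eqxx.
case/andP=> xay ys /andP[nas us].
have [s' [yzs' les' subs']] := IHs y ys us.
have [xs'|nxs'] := boolP (x \in y :: unzip2 s').
  have [s'' [xzs'' les'' subs'']] := hpath_suffix yzs' xs'.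
  exists s''; split; rewrite ?(leq_trans les'') ?leqW //.
  by move=> b /subs'' /subs'; rewrite inE orbC => ->.
exists ((a, y) :: s'); split=> //; last first.
  by move=> b; rewrite !inE => /predU1P[-> | /subs' ->]; rewrite ?eqxx ?orbT.
move: yzs' => /and4P[/= ys' uy us' lasts'].
by apply/and4P; split; rewrite //= ?xay ?ys' ?nxs' ?uy ?us' ?andbT // (contra (subs' a)).
Qed.

Lemma reach1 a x y : a \in arcs x y -> reach 1 x y.
Proof. by move=> xay; apply: (@hwalk_reach x [:: (a, y)]); rewrite /= ?xay. Qed.

Lemma reach2 a b x y z :
  a \in arcs x y -> b \in arcs y z -> a != b -> reach 2 x z.
Proof.
move=> xay ybz nab; apply: (@hwalk_reach x [:: (a, y); (b, z)]).
  by rewrite /= xay ybz.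
by rewrite /= inE nab.
Qed.

Lemma reach3 a1 a2 a3 x y z t :
  a1 \in arcs x y -> a2 \in arcs y z -> a3 \in arcs z t ->
  uniq [:: a1; a2; a3] -> reach 3 x t.
Proof.
move=> xy yz zt ua.
by apply: (@hwalk_reach x [:: (a1, y); (a2, z); (a3, t)]); rewrite //= xy yz zt.
Qed.

Lemma reach4 a1 a2 a3 a4 x y z t v :
  a1 \in arcs x y -> a2 \in arcs y z -> a3 \in arcs z t -> a4 \in arcs t v ->
  uniq [:: a1; a2; a3; a4] -> reach 4 x v.
Proof.
move=> xy yz zt tv ua.
apply: (@hwalk_reach x [:: (a1, y); (a2, z); (a3, t); (a4, v)]) => //=.
by rewrite xy yz zt tv.
Qed.

Lemma size_uniq_in_arc a (vs : seq V) :
  uniq vs -> {subset vs <= a} -> size vs <= k.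
Proof. by move=> uvs sub; have:= uniq_leq_size uvs sub; rewrite size_tuple. Qed.

Section Realization.

Hypothesis inj_arcs : {in A &, forall a b, [set x in a] = [set x in b] -> a = b}.

(** At least [k] common distinct vertices exhaust both arcs, so their vertex sets coincide. *)
Lemma arc_determined a b (vs : seq V) :
    a \in A -> b \in A -> uniq vs -> k <= size vs ->
    {subset vs <= a} -> {subset vs <= b} -> a = b.
Proof.
move=> aA bA uvs lek suba subb; apply: inj_arcs => //.
have Evs (d : k.-tuple V) : {subset vs <= d} -> [set x in vs] = [set x in d].
  move=> subd; apply/eqP; rewrite eqEcard; apply/andP; split.
    by apply/subsetP=> x; rewrite !inE; apply: subd.
  rewrite !cardsE (card_uniqP uvs) (leq_trans _ lek) //.
  by rewrite (leq_trans (card_size _)) // size_tuple.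
by rewrite -!Evs.
Qed.

Lemma walk2_reach x1 x2 x3 :
  0 < #|arcs x1 x2| -> 1 < #|arcs x2 x3| -> reach 2 x1 x3.
Proof.
move=> /card_gt0P[a a1] gt2; have [b b2 nba] := exists_other a gt2.
by apply: (reach2 a1 b2 _); rewrite eq_sym.
Qed.

(* If some arc d of [arcs x1 x2] also lies in the next two sets, then d alone
   leads from x1 to x4, or to x3 when x1 and x4 share a part; otherwise distinct
   representatives exist. *)
Lemma walk3_reach x1 x2 x3 x4 :
    1 < #|arcs x1 x2| -> 1 < #|arcs x2 x3| -> 1 < #|arcs x3 x4| ->
  reach 3 x1 x4.
Proof.
move=> gt1 gt2 gt3.
have [d d1] : exists d, d \in arcs x1 x2 by apply/card_gt0P; apply: ltnW.
have [d2|nd2] := boolP (d \in arcs x2 x3); last first.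
  have [b b3 nbd] := exists_other d gt3; have [c c2 ncb] := exists_other b gt2.
  apply: (reach3 d1 c2 b3 _); distinct.
  by apply: contraNneq nd2 => ->.
have [d3|nd3] := boolP (d \in arcs x3 x4); last first.
  have [b b2 nbd] := exists_other d gt2; have [c c3 ncb] := exists_other b gt3.
  apply: (reach3 d1 b2 c3 _); distinct.
  by apply: contraNneq nd3 => ->.
have p12 := arcs_precedes d1; have p23 := arcs_precedes d2.
have p34 := arcs_precedes d3; have p13 := precedes_trans p12 p23.
have dA := arcsA d1; have [E14|n14] := eqVneq (part x1) (part x4); last first.
  by apply: (reachW _ (reach1 (precedes_arcs n14 dA (precedes_trans p13 p34)))).
have n13 : part x1 != part x3 by rewrite E14 eq_sym (arcs_part d3).
have [b b3 nbd] := exists_other d gt3.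
by apply: (reachW _ (reach2 (precedes_arcs n13 dA p13) b3 _)); rewrite // eq_sym.
Qed.

(** The arc [d] jumps from [x1] to [x4]. If these share a part, it jumps to [x3] instead, or
    straight to [x5] when it also serves the last edge. *)
Lemma walk4_reach_early d x1 x2 x3 x4 x5 :
    1 < #|arcs x3 x4| -> 1 < #|arcs x4 x5| ->
    d \in arcs x1 x2 -> d \in arcs x2 x3 -> d \in arcs x3 x4 ->
  reach 4 x1 x5.
Proof.
move=> gt3 gt4 d1 d2 d3.
have p12 := arcs_precedes d1; have p23 := arcs_precedes d2.
have p34 := arcs_precedes d3; have p13 := precedes_trans p12 p23.
have p14 := precedes_trans p13 p34.
have dA := arcsA d1; have [E14|n14] := eqVneq (part x1) (part x4); last first.
  have [b b4 nbd] := exists_other d gt4.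
  by apply: (reachW _ (reach2 (precedes_arcs n14 dA p14) b4 _)); rewrite // eq_sym.
have n13 : part x1 != part x3 by rewrite E14 eq_sym (arcs_part d3).
have [d4|nd4] := boolP (d \in arcs x4 x5).
  have n15 : part x1 != part x5 by rewrite E14 (arcs_part d4).
  have p15 := precedes_trans p14 (arcs_precedes d4).
  exact: (reachW _ (reach1 (precedes_arcs n15 dA p15))).
have [b b3 nbd] := exists_other d gt3; have [c c4 ncb] := exists_other b gt4.
apply: (reachW _ (reach3 (precedes_arcs n13 dA p13) b3 c4 _)) => //; distinct.
by apply: contraNneq nd4 => ->.
Qed.

(** Mirror image of [walk4_reach_early]. *)
Lemma walk4_reach_late d x1 x2 x3 x4 x5 :
    1 < #|arcs x1 x2| -> 1 < #|arcs x2 x3| ->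
    d \in arcs x2 x3 -> d \in arcs x3 x4 -> d \in arcs x4 x5 ->
  reach 4 x1 x5.
Proof.
move=> gt1 gt2 d2 d3 d4.
have p23 := arcs_precedes d2; have p34 := arcs_precedes d3.
have p45 := arcs_precedes d4; have p35 := precedes_trans p34 p45.
have p25 := precedes_trans p23 p35.
have dA := arcsA d2; have [E25|n25] := eqVneq (part x2) (part x5); last first.
  have [b b1 nbd] := exists_other d gt1.
  exact: (reachW _ (reach2 b1 (precedes_arcs n25 dA p25) nbd)).
have n35 : part x3 != part x5 by rewrite -E25 eq_sym (arcs_part d2).
have [d1|nd1] := boolP (d \in arcs x1 x2).
  have n15 : part x1 != part x5 by rewrite -E25 (arcs_part d1).
  have p15 := precedes_trans (arcs_precedes d1) p25.
  exact: (reachW _ (reach1 (precedes_arcs n15 dA p15))).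
have [b b2 nbd] := exists_other d gt2; have [c c1 ncb] := exists_other b gt1.
apply: (reachW _ (reach3 c1 b2 (precedes_arcs n35 dA p35) _)) => //; distinct.
by apply: contraNneq nd1 => <-.
Qed.

(** Without an arc serving three consecutive edges, distinct representatives exist. For [k <= 5], an
    arc serving both outer edges and an inner one contains all five vertices, so there is at most
    one. For [5 < k] there may be several, whence the stronger bound on the arc sets. *)
Lemma walk4_reach x1 x2 x3 x4 x5 : uniq [:: x1; x2; x3; x4; x5] ->
    1 < #|arcs x1 x2| -> 1 < #|arcs x2 x3| ->
    1 < #|arcs x3 x4| -> 1 < #|arcs x4 x5| ->
    (5 < k -> [/\ 2 < #|arcs x1 x2|, 2 < #|arcs x2 x3|,
                  2 < #|arcs x3 x4| & 2 < #|arcs x4 x5|]) ->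
  reach 4 x1 x5.
Proof.
move=> ux gt1 gt2 gt3 gt4 large.
have [/pred0Pn[d /andP[/setIP[d1 d2] d3]]|/negPn dis123] :=
  boolP (~~ [disjoint arcs x1 x2 :&: arcs x2 x3 & arcs x3 x4]).
  exact: (walk4_reach_early _ _ d1 d2 d3).
have [/pred0Pn[d /andP[/setIP[d2 d3] d4]]|/negPn dis234] :=
  boolP (~~ [disjoint arcs x2 x3 :&: arcs x3 x4 & arcs x4 x5]).
  exact: (walk4_reach_late _ _ d2 d3 d4).
suff [a1 [a2 [a3 [a4 [[]]]]]] : distinct_reps4 (arcs x1 x2) (arcs x2 x3)
    (arcs x3 x4) (arcs x4 x5) by apply: reach4.
have [lek|/large[]] := leqP k 5; last first.
  by move=> *; apply: distinct_reps4_ge3.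
apply: distinct_reps4_ge2 => // a b ab bb.
have sub a' : a' \in arcs x1 x2 :&: arcs x4 x5 :&: (arcs x2 x3 :|: arcs x3 x4) ->
    {subset [:: x1; x2; x3; x4; x5] <= a'}.
  case/setIP=> /setIP[a1 a4] a23; apply/allP => /=.
  rewrite (arcs_tail a1) (arcs_head a1) (arcs_tail a4) (arcs_head a4) /=.
  by case/setUP: a23 => [/arcs_head->|/arcs_tail->].
have A5 a' : a' \in arcs x1 x2 :&: arcs x4 x5 :&: (arcs x2 x3 :|: arcs x3 x4) ->
    a' \in A by case/setIP=> /setIP[/arcsA].
by apply: arc_determined ux _ _ _; rewrite ?A5 //; apply: sub.
Qed.

End Realization.

(** * The exceptional case of four vertices and arcs of size three *)

Section FourVertices.

Hypothesis inj_arcs : {in A &, forall a b, [set x in a] = [set x in b] -> a = b}.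
Hypothesis k3 : k = 3.
Hypothesis cardV4 : #|V| = 4.
Hypothesis two_arcs :
  forall u w, part u != part w -> 1 < #|arcs u w| + #|arcs w u|.
Hypothesis no_transmitter : forall v, exists u a, a \in arcs u v.

Lemma cover_uniq4 (vs : seq V) y : uniq vs -> size vs = 4 -> y \in vs.
Proof.
move=> uvs svs; have: [set x in vs] == [set: V].
  by rewrite eqEcard subsetT cardsT cardV4 cardsE (card_uniqP uvs) svs.
by move/eqP/setP/(_ y); rewrite !inE.
Qed.

Lemma not_in_arc a x y z t : uniq [:: x; y; z; t] ->
  x \in a -> y \in a -> z \in a -> t \notin a.
Proof.
move=> uxs xa ya za; apply/negP=> ta.
suff: 4 <= 3 by [].
rewrite -[X in _ <= X]k3; apply: (size_uniq_in_arc uxs (a := a)).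
by apply/allP; rewrite /= xa ya za ta.
Qed.

Lemma arcs_asym a u w : a \in arcs u w -> a \notin arcs w u.
Proof.
move=> /arcs_precedes/and3P[_ _ ltuw].
by apply/negP=> /arcs_precedes/and3P[_ _]; rewrite ltnNge ltnW.
Qed.

Lemma reverse_arc u w : part u != part w -> #|arcs u w| <= 1 ->
  exists b, b \in arcs w u.
Proof.
move=> /two_arcs gt1 le1; apply/card_gt0P; rewrite lt0n.
by apply: contraL gt1 => /eqP->; rewrite addn0 -leqNgt.
Qed.

(* Here v, w or the fourth vertex z is the king. *)
Lemma blocked_path_king a u w v :
    u != v -> part u = part v -> a \in arcs u w -> a \in arcs w v ->
    arcs u w \subset [set a] -> arcs w v \subset [set a] ->
  exists x, king P A 4 x.
Proof.
move=> nuv Euv a1 a2 sub1 sub2.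
have part_neq x y : part x != part y -> x != y by apply: contraNneq => ->.
have nuw := part_neq _ _ (arcs_part a1); have nwv := part_neq _ _ (arcs_part a2).
have [z] : exists z, z \notin [:: u; w; v].
  apply/existsP; rewrite -negb_forall; apply/negP=> /forallP all3.
  have:= card_size [:: u; w; v]; suff -> : #|[:: u; w; v]| = 4 by [].
  by rewrite -cardV4; apply: eq_card => x; rewrite all3.
rewrite !inE !negb_or => /and3P[nzu nzw nzv].
have uVs : uniq [:: u; w; v; z] by distinct.
have cover y : y \in [:: u; w; v; z] by apply: cover_uniq4.
have card1 x y : arcs x y \subset [set a] -> #|arcs x y| <= 1.
  by move=> s; rewrite -(cards1 a) subset_leq_card.
have [b bwu] := reverse_arc (arcs_part a1) (card1 _ _ sub1).
have [c cvw] := reverse_arc (arcs_part a2) (card1 _ _ sub2).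
have in_a : {subset [:: u; w; v] <= a}.
  by apply/allP; rewrite /= (arcs_tail a1) (arcs_head a1) (arcs_head a2).
(* An arc opposing [a] on one of its edges cannot contain the third vertex of [a]: it would have the
   vertex set of [a], hence equal [a]. So [b] misses [v] and [c] misses [u]. *)
have nin d x y t : d \in arcs x y -> {subset [:: u; w; v] <= [:: x; y; t]} ->
    a \in arcs y x -> t \notin d.
  move=> dxy sub3 ayx; apply: contraL ayx => td.
  suff -> : a = d by apply: arcs_asym.
  apply: (arc_determined inj_arcs (vs := [:: u; w; v])) => //.
  - exact: arcsA a1.
  - exact: arcsA dxy.
  - by distinct.
  - by rewrite k3.
  move=> s /sub3; rewrite !inE => /or3P[] /eqP-> //.
  - exact: arcs_tail dxy.
  - exact: arcs_head dxy.
have nvb : v \notin b by apply: nin bwu _ a1 => s; rewrite !inE orbCA orbA.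
have nuc : u \notin c.
  by apply: nin cvw _ a2 => s; rewrite !inE orbC -orbA orbCA orbC -orbA.
have ncb : c != b.
  by apply: contraNneq nvb => <-; apply: arcs_tail cvw.
(* If [z] shares the part of [u] and [v], only [w] can precede [z], and it does since [z] is no
   transmitter; then [w] is a king. *)
have [Ezu|nzu_part] := eqVneq (part z) (part u).
  exists w => y; have:= cover y; rewrite !inE => /or4P[] /eqP->.
  - exact: (reachW _ (reach1 bwu)).
  - exact: reach_refl.
  - exact: (reachW _ (reach1 a2)).
  have [t [d dtz]] := no_transmitter z; have:= cover t; rewrite !inE.
  case/or4P=> /eqP Et; move: (dtz) (arcs_part dtz); rewrite Et ?Ezu -?Euv ?eqxx //.
  by move=> dwz _; apply: (reachW _ (reach1 dwz)).
have nvz_part : part v != part z by rewrite -Euv eq_sym.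
(* An arc from [v] to [z] makes [v] a king. Otherwise two arcs lead from [z] to [v]; one differs
   from [c], and [z] is a king. *)
have [arcs0|[d dvz]] := set_0Vmem (arcs v z); last first.
  exists v => y; have:= cover y; rewrite !inE => /or4P[] /eqP->.
  - exact: (reachW _ (reach2 cvw bwu ncb)).
  - exact: (reachW _ (reach1 cvw)).
  - exact: reach_refl.
  - exact: (reachW _ (reach1 dvz)).
have:= two_arcs nvz_part; rewrite arcs0 cards0 add0n => gtzv.
have [d dzv ndc] := exists_other c gtzv.
exists z => y; have:= cover y; rewrite !inE => /or4P[] /eqP->.
- apply: (reachW _ (reach3 dzv cvw bwu _)) => //; distinct.
  by apply: contraNneq nvb => <-; apply: arcs_head dzv.
- exact: (reachW _ (reach2 dzv cvw ndc)).
- exact: (reachW _ (reach1 dzv)).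
- exact: reach_refl.
Qed.

(** Distinct arcs fail to exist only if both sets are the same singleton. Its arc then leads from
    [u] to [v] directly, unless these share a part, which is the blocked situation. *)
Lemma walk2_or_king u w v :
    u != v -> 0 < #|arcs u w| -> 0 < #|arcs w v| ->
  (exists x, king P A 4 x) \/ reach 2 u v.
Proof.
move=> nuv /card_gt0P[a a1] /card_gt0P[b b2].
have [Eab|nab] := eqVneq a b; last by right; apply: (reach2 a1 b2).
move: b2; rewrite -Eab => a2.
have [sub1|/subsetPn[d d1]] := boolP (arcs u w \subset [set a]); last first.
  by rewrite inE => nda; right; apply: (reach2 d1 a2).
have [sub2|/subsetPn[d d2]] := boolP (arcs w v \subset [set a]); last first.
  by rewrite inE eq_sym => nad; right; apply: (reach2 a1 d2).
have [Euv|nuv_part] := eqVneq (part u) (part v).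
  by left; apply: blocked_path_king nuv Euv a1 a2 sub1 sub2.
right; apply: (@reachW 1) => //.
apply: (reach1 (precedes_arcs nuv_part (arcsA a1) _)).
exact: precedes_trans (arcs_precedes a1) (arcs_precedes a2).
Qed.

(** If no arc leads from [x1] to [x4], then [x4] is a king: two arcs lead back to [x1], one of them
    distinct from [a], and one leads back to [x3]. *)
Lemma crossing_walk_or_king x1 x2 x3 x4 a b : uniq [:: x1; x2; x3; x4] ->
    part x1 = part x3 -> part x2 = part x4 ->
    a \in arcs x1 x2 -> b \in arcs x3 x4 -> arcs x3 x4 \subset [set b] ->
  (exists x, king P A 4 x) \/ reach 3 x1 x4.
Proof.
move=> ux E13 E24 a1 b3 sub3.
have n14 : part x1 != part x4 by rewrite E13 (arcs_part b3).
have [arcs0|[d d14]] := set_0Vmem (arcs x1 x4); last first.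
  by right; apply: (reachW _ (reach1 d14)).
have:= two_arcs n14; rewrite arcs0 cards0 add0n => gt41.
have [d d41 nda] := exists_other a gt41.
have [|c c43] := @reverse_arc x3 x4 (arcs_part b3).
  by rewrite -(cards1 b) subset_leq_card.
left; exists x4 => y; have:= @cover_uniq4 _ y ux erefl.
rewrite !inE => /or4P[] /eqP->.
- exact: (reachW _ (reach1 d41)).
- exact: (reachW _ (reach2 d41 a1 nda)).
- exact: (reachW _ (reach1 c43)).
- exact: reach_refl.
Qed.

(** No arc has four vertices, so the outer arc sets are disjoint, and a middle arc is usable unless
    it is the sole element of an outer set. Such an arc serves two consecutive edges and gives a
    shortcut if the ends of these lie in different parts. Otherwise the walk is blocked, a second
    middle arc helps, or the parts alternate as in [crossing_walk_or_king]. *)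
Lemma walk3_or_king x1 x2 x3 x4 : uniq [:: x1; x2; x3; x4] ->
    0 < #|arcs x1 x2| -> 0 < #|arcs x2 x3| -> 0 < #|arcs x3 x4| ->
  (exists x, king P A 4 x) \/ reach 3 x1 x4.
Proof.
move=> ux /card_gt0P[a1 a1P] /card_gt0P[d d2] /card_gt0P[a3 a3P].
have dis13 a b : a \in arcs x1 x2 -> b \in arcs x3 x4 -> a != b.
  move=> aP; apply: contraTneq => <-; apply/negP=> aP'.
  have:= not_in_arc ux (arcs_tail aP) (arcs_head aP) (arcs_tail aP').
  by rewrite (arcs_head aP').
have [n13 n24] : x1 != x3 /\ x2 != x4.
  by move: ux; rewrite /= !inE !negb_or => /and4P[/and3P[_ ? _] /andP[_ ?] _ _].
have free2 c : c \in arcs x2 x3 -> ~~ (arcs x1 x2 \subset [set c]) ->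
    ~~ (arcs x3 x4 \subset [set c]) -> reach 3 x1 x4.
  move=> c2 /subsetPn[b1 b1P nb1c] /subsetPn[b3 b3P nb3c].
  rewrite !inE in nb1c nb3c; have nb13 := dis13 _ _ b1P b3P.
  by apply: (reach3 b1P c2 b3P); distinct.
have [sub1|nsub1] := boolP (arcs x1 x2 \subset [set d]).
  have d1 : d \in arcs x1 x2 by have:= subsetP sub1 _ a1P; rewrite inE => /eqP <-.
  have nda3 := dis13 _ _ d1 a3P.
  have [E13|n13'] := eqVneq (part x1) (part x3); last first.
    right; apply: (@reachW 2) => //; apply: (reach2 _ a3P nda3).
    apply: (precedes_arcs n13' (arcsA d1)).
    exact: precedes_trans (arcs_precedes d1) (arcs_precedes d2).
  have [sub2|/subsetPn[d' d'2]] := boolP (arcs x2 x3 \subset [set d]).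
    by left; apply: blocked_path_king n13 E13 d1 d2 sub1 sub2.
  rewrite inE => nd'd.
  have [sub3|nsub3] := boolP (arcs x3 x4 \subset [set d']); last first.
    right; apply: free2 d'2 _ nsub3.
    by apply/subsetPn; exists d; rewrite // inE eq_sym.
  have d'3 : d' \in arcs x3 x4 by have:= subsetP sub3 _ a3P; rewrite inE => /eqP <-.
  have [E24|n24'] := eqVneq (part x2) (part x4).
    exact: crossing_walk_or_king ux E13 E24 d1 d'3 sub3.
  right; apply: (@reachW 2) => //; apply: (reach2 d1 _ (dis13 _ _ d1 d'3)).
  apply: (precedes_arcs n24' (arcsA d'2)).
  exact: precedes_trans (arcs_precedes d'2) (arcs_precedes d'3).
have [sub3|nsub3] := boolP (arcs x3 x4 \subset [set d]); last first.
  by right; apply: free2 d2 nsub1 nsub3.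
have d3 : d \in arcs x3 x4 by have:= subsetP sub3 _ a3P; rewrite inE => /eqP <-.
have [E24|n24'] := eqVneq (part x2) (part x4); last first.
  right; apply: (@reachW 2) => //; apply: (reach2 a1P _ (dis13 _ _ a1P d3)).
  apply: (precedes_arcs n24' (arcsA d2)).
  exact: precedes_trans (arcs_precedes d2) (arcs_precedes d3).
have [sub2|/subsetPn[d' d'2]] := boolP (arcs x2 x3 \subset [set d]).
  by left; apply: blocked_path_king n24 E24 d2 d3 sub2 sub3.
rewrite inE => nd'd.
have [sub1|nsub1'] := boolP (arcs x1 x2 \subset [set d']); last first.
  right; apply: free2 d'2 nsub1' _.
  by apply/subsetPn; exists d; rewrite // inE eq_sym.
have d'1 : d' \in arcs x1 x2 by have:= subsetP sub1 _ a1P; rewrite inE => /eqP <-.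
have [E13|n13'] := eqVneq (part x1) (part x3).
  exact: crossing_walk_or_king ux E13 E24 d'1 d3 sub3.
right; apply: (@reachW 2) => //; apply: (reach2 _ d3 nd'd).
apply: (precedes_arcs n13' (arcsA d'1)).
exact: precedes_trans (arcs_precedes d'1) (arcs_precedes d'2).
Qed.

End FourVertices.

(** An arc of size two holds only the ends of its edge, so arcs along distinct vertices are
    distinct. The invariant puts two vertices of the remaining path into each later arc; containing
    [x] too would give it three. *)
Lemma walk_reach_k2 x p : k = 2 ->
    path (fun u w => 0 < #|arcs u w|) x p -> uniq (x :: p) ->
  reach (size p) x (last x p).
Proof.
move=> k2 xp up.
suff [s [Es xs us _]] : exists s, [/\ unzip2 s = p, hwalk P A x s, uniq (unzip1 s)
    & forall b, b \in unzip1 s -> exists u w,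
        [/\ u != w, u \in x :: p, w \in x :: p, u \in b & w \in b]].
  by rewrite -Es size_map; apply: hwalk_reach.
elim: p x xp up => [|y p IHp] x /=; first by exists [::].
case/andP=> /card_gt0P[a axy] yp /andP[nx up].
have [s [Es ys us in_s]] := IHp y yp up.
exists ((a, y) :: s); split=> /=; rewrite ?Es ?axy ?us ?andbT //.
  apply/negP=> /in_s[u [w [nuw up' wp' ua wa]]].
  suff: 3 <= 2 by [].
  rewrite -[X in _ <= X]k2; apply: (@size_uniq_in_arc a [:: x; u; w]).
    by distinct; apply: contraNneq nx => ->.
  by apply/allP; rewrite /= (arcs_tail axy) ua wa.
move=> b; rewrite inE => /predU1P[-> | /in_s[u [w [nuw up' wp' ub wb]]]].
  exists x, y; rewrite (arcs_tail axy) (arcs_head axy) !inE !eqxx orbT; split=> //.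
  by apply: contraNneq (arcs_part axy) => ->.
by exists u, w; split=> //; rewrite inE ?up' ?wp' orbT.
Qed.

(** Other parts are one arc away. A vertex [y] in the part of [t] is entered by some arc [a] from a
    [z], and an arc from [t] to [z] other than [a] is needed. For [k = 2], [a] misses [t]; otherwise
    the strict majority of at least two arcs contains two. *)
Lemma source_king t : (k = 2 \/
      forall u w, part u != part w -> 1 < #|arcs u w| + #|arcs w u|) ->
    (forall w, part w != part t -> #|arcs w t| < #|arcs t w|) ->
    (forall y, y != t -> ~~ transmitter P A y) ->
  king P A 2 t.
Proof.
move=> big src nt y; have [->|nyt] := eqVneq y t; first exact: reach_refl.
have [Eyt|nyt'] := eqVneq (part y) (part t); last first.
  have /card_gt0P[a aty] := leq_ltn_trans (leq0n _) (src y nyt').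
  exact: (reachW _ (reach1 aty)).
have /forallPn[z] := nt y nyt.
rewrite negb_imply => /andP[nzy /set0Pn[a azy]].
have nzt : part z != part t by rewrite -Eyt.
have ltzt := src z nzt.
suff [b btz nba] : exists2 b, b \in arcs t z & b != a.
  exact: (reach2 btz azy nba).
case: big => [k2 | big].
  have /card_gt0P[b btz] := leq_ltn_trans (leq0n _) ltzt.
  exists b => //; apply: contraTneq btz => ->; apply/negP=> atz.
  suff: 3 <= 2 by [].
  rewrite -[X in _ <= X]k2; apply: (@size_uniq_in_arc a [:: t; z; y]).
    distinct; first by apply: contraNneq nzt => ->.
    by apply: contraNneq nzy => ->.
  by apply/allP; rewrite /= (arcs_tail atz) (arcs_head atz) (arcs_head azy).
apply: exists_other; have:= big _ _ nzt; move: ltzt.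
by case: #|arcs t z| => [|[|m]] //; rewrite ltnS leqn0 => /eqP->.
Qed.

(** * Counting the arcs through two vertices of different parts *)

Section Multipartite.

Hypothesis partP : partition P [set: V].
Hypothesis HA : multipartite_hypertournament P A.

Lemma multipartite_inj :
  {in A &, forall a b, [set x in a] = [set x in b] -> a = b}.
Proof.
have [T [uniqT exT] ->] := HA.
move=> a b; rewrite !inE => /andP[aT _] /andP[bT _] Eab.
have [|c [_ Hc]] := exT [set x in b].
  by rewrite cardsE (card_uniqP (uniqT _ bT)) size_tuple.
by rewrite -(Hc a) // -(Hc b).
Qed.

(** Adding [u] and [w] to a [k - 2]-subset of the other vertices gives a [k]-set whose arc is not
    deleted, as it meets two parts. Distinct sets have distinct arcs. *)
Lemma card_arcs_ge u w : 2 <= k -> part u != part w ->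
  'C(#|V| - 2, k - 2) <= #|arcs u w| + #|arcs w u|.
Proof.
have [T [uniqT exT] EA] := HA; move=> k2 nuw.
have nuw' : u != w by apply: contraNneq nuw => ->.
set W := ~: [set u; w]; have cardW : #|V| - 2 = #|W|.
  by rewrite -(cardsC [set u; w]) cards2 nuw' addKn.
rewrite cardW -cards_draws.
set D := [set S | _]; pose g (S : {set V}) := [set u; w] :|: S.
have injg : {in D &, injective g}.
  move=> S S'; rewrite !inE => /andP[SW _] /andP[SW' _] Eg.
  have gW (R : {set V}) : R \subset W -> R = g R :&: W.
    by move=> RW; rewrite setIUl setICr set0U; apply/esym/setIidPl.
  by rewrite (gW S) // (gW S') // Eg.
rewrite -(card_in_imset injg).
apply: leq_trans (_ : #|arcs u w :|: arcs w u| <= _); last first.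
  by rewrite leq_card_setU.
apply: leq_trans (leq_imset_card (fun a : k.-tuple V => [set x in a]) _).
apply/subset_leq_card/subsetP=> _ /imsetP[S SD ->].
have [a [[aT Ea] _]] : exists! a : k.-tuple V, a \in T /\ [set x in a] = g S.
  apply: exT; move: SD; rewrite inE => /andP[SW /eqP cardS].
  rewrite cardsU disjoint_setI0 ?cards0 ?subn0 ?cards2 ?nuw' ?cardS ?subnKC //.
  by rewrite disjoint_sym disjoints_subset.
apply/imsetP; exists a => //.
have g_in_a x : x \in g S -> x \in a by rewrite -Ea inE.
have ua : u \in a by rewrite g_in_a // !inE eqxx.
have wa : w \in a by rewrite g_in_a // !inE eqxx orbT.
have aA : a \in A.
  rewrite EA inE aT; apply/exists_inPn=> X PX; apply: contra nuw => /subsetP aX.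
  have trivP : trivIset P by case/and3P: partP.
  by rewrite !(def_pblock trivP PX) // aX ?inE.
rewrite inE !mem_arcs [part w == _]eq_sym nuw aA /precedes ua wa /=.
case: ltngtP => // Ei.
by move/eqP: nuw'; case; rewrite -(nth_index u ua) Ei nth_index.
Qed.

End Multipartite.
End Reachability.

(** * Assembling the theorem *)

(** Finiteness replaces excluded middle for [Q], which will be the existence of a 4-king. *)
Lemma forall_or_const (T : finType) (Q : Prop) (R : T -> Prop) :
  (forall y, Q \/ R y) -> Q \/ forall y, R y.
Proof.
move=> QR; suff [q|Rall] : Q \/ {in enum T, forall y, R y}; first by left.
  by right=> y; apply: Rall; rewrite mem_enum.
elim: (enum T) => [|x s [q|IHs]]; [by right | by left |].
by case: (QR x) => [q|Rx]; [left | right=> y /predU1P[-> // | /IHs]].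
Qed.

Theorem theorem11 (n k p : nat) (V : finType) (P : {set {set V}})
    (A : {set k.-tuple V})
    (k_ge2 : 2 <= k) (k_lt_n : k < n) (p_ge2 : 2 <= p)
    (cardV : #|V| = n) (partP : partition P [set: V]) (cardP : #|P| = p)
    (HA : multipartite_hypertournament P A)
    (one_transmitter : #|[set v | transmitter P A v]| <= 1) :
  exists x : V, king P A 4 x.
Proof.
set f := fun u w => #|arcs_between P A u w|.
have inj := multipartite_inj HA.
have f_pos u w : pblock P u != pblock P w -> 0 < f u w + f w u.
  move=> nuw; apply: leq_trans (card_arcs_ge partP HA k_ge2 nuw).
  by rewrite bin_gt0 cardV leq_sub2r // ltnW.
have f_ge u w : 2 < k -> pblock P u != pblock P w -> n - 2 <= f u w + f w u.
  move=> k_gt2 nuw; apply: leq_trans (card_arcs_ge partP HA k_ge2 nuw).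
  rewrite cardV leq_bin_self // subn_gt0 k_gt2 ltn_sub2r //.
  exact: ltn_trans k_lt_n.
have big : k = 2 \/
    forall u w, pblock P u != pblock P w -> 1 < f u w + f w u.
  move: k_ge2; rewrite leq_eqVlt => /orP[/eqP<-|k_gt2]; [by left | right=> u w nuw].
  apply: leq_trans (f_ge u w k_gt2 nuw).
  by rewrite ltn_subRL (leq_trans _ k_lt_n).
have king2W t : king P A 2 t -> exists x, king P A 4 x.
  by move=> king2; exists t => y; apply: reachW (king2 y).
have [/existsP[t tr_t]|/existsPn no_tr] := boolP [exists t, transmitter P A t].
  apply: (king2W t); apply: source_king big _ _ => [w nwt|y].
    have /eqP E0 : arcs_between P A w t == set0 by have:= forallP tr_t w; rewrite nwt.
    by have:= f_pos w t nwt; rewrite /f E0 cards0.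
  apply: contra => tr_y; apply/eqP.
  by apply: (card_le1_eqP one_transmitter); rewrite inE.
pose e u w := (pblock P u != pblock P w) && (f w u <= f u w).
have e_tot u w : pblock P u != pblock P w -> e u w || e w u.
  by rewrite /e [pblock P w == _]eq_sym => -> /=; apply: leq_total.
have [/existsP[t /forallP src]|/existsPn no_src] :=
  boolP [exists t, [forall u, ~~ e u t]].
  apply: (king2W t); apply: source_king big _ _ => [w nwt|y _]; last exact: no_tr.
  by have:= src w; rewrite /e nwt /= -ltnNge.
have no_source v : exists u, e u v.
  by have /forallPn[u /negPn] := no_src v; exists u.
have v0 : V by have /card_gt0P/sigW[v] : 0 < #|V|; rewrite ?cardV ?(leq_trans _ k_lt_n).
have [u w /andP[]|x x_king] // := semicomplete_king _ e_tot no_source v0.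
suff [//|reach_all] : (exists t, king P A 4 t) \/ forall y, reach P A 4 x y.
  by exists x.
apply: forall_or_const => y; have [p' xp' [<- lep']] := x_king y.
case/shortenP: xp' => q xq uq sub_q.
have leq4 : size q <= 4.
  by apply: leq_trans lep'; apply: uniq_leq_size sub_q; case/andP: uq.
have e_pos u w : e u w -> 0 < f u w.
  case/andP=> nuw le_wu; have:= f_pos _ _ nuw.
  by rewrite addn_gt0 => /orP[//|/leq_trans->].
case: (ltngtP k 2) k_ge2 => // [k_gt2 _ | k2 _]; last first.
  right; apply: reachW leq4 (walk_reach_k2 k2 _ uq).
  by apply: sub_path xq => u w /e_pos.
(* For [n <= 4], the inequalities [2 < k < n] force [k = 3] and [n = 4]. *)
have [n_gt4|] := ltnP 4 n; last first.
  move=> n_le4.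
  have k3 : k = 3 by apply/eqP; rewrite eqn_leq k_gt2 andbT -ltnS (leq_trans k_lt_n).
  have V4 : #|V| = 4.
    by apply/eqP; rewrite cardV eqn_leq n_le4 -k3.
  have two u w : pblock P u != pblock P w -> 1 < f u w + f w u.
    by case: big k_gt2 => [->|big _]; last exact: big.
  have nt v : exists u a, a \in arcs_between P A u v.
    have /forallPn[u] := no_tr v; rewrite negb_imply => /andP[_ /set0Pn[a ua]].
    by exists u, a.
  have le3 : size q <= 3.
    by rewrite -ltnS -[4]V4; have:= max_card (mem (x :: q)); rewrite (card_uniqP uq).
  case: q xq uq le3 {sub_q leq4} => [|y1 [|y2 [|y3 [|]]]] //=.
  - by move=> _ _ _; right; apply: reach_refl.
  - rewrite andbT => /e_pos/card_gt0P[a ay] _ _; right.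
    exact: (reachW _ (reach1 ay)).
  - case/and3P=> /e_pos e1 /e_pos e2 _ /and3P[]; rewrite !inE negb_or.
    case/andP=> _ nxy _ _ _.
    have [|r] := walk2_or_king inj k3 V4 two nt nxy e1 e2; first by left.
    by right; apply: reachW r.
  case/and4P=> /e_pos e1 /e_pos e2 /e_pos e3 _ uq _.
  have [|r] := walk3_or_king inj k3 V4 two nt uq e1 e2 e3; first by left.
  by right; apply: reachW r.
(* An edge carries at least half of the [n - 2] or more arcs. Then [4 < n] allows [m = 1], and
   [5 < k < n] allows [m = 2]. *)
have e_gt m u w : m.*2 < n - 2 -> e u w -> m < f u w.
  move=> ltm /andP[nuw le_wu]; rewrite -ltn_double.
  apply: leq_trans ltm (leq_trans (f_ge u w k_gt2 nuw) _).
  by rewrite -addnn leq_add2l.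
have e2 u w : e u w -> 1 < f u w by apply: e_gt; rewrite ltn_subRL.
right; case: q xq uq leq4 {sub_q} => [|y1 [|y2 [|y3 [|y4 [|]]]]] //=.
- by move=> _ _ _; apply: reach_refl.
- rewrite andbT => /e_pos/card_gt0P[a ay] _ _.
  exact: (reachW _ (reach1 ay)).
- case/and3P=> /e_pos e1 /e2 e2' _ _ _.
  exact: reachW (walk2_reach e1 e2').
- case/and4P=> /e2 e1 /e2 e2' /e2 e3 _ _ _.
  exact: reachW (walk3_reach e1 e2' e3).
case/and5P=> e1 e2' e3 e4 _ uq _.
apply: (walk4_reach inj uq); rewrite ?e2 // => k_gt5.
have e3' u w : e u w -> 2 < f u w.
  by apply: e_gt; rewrite ltn_subRL; apply: leq_trans k_lt_n.
by split; apply: e3'.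
Qed.
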